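(* Let $N\ge 2$ and let $(v_h^n)_{n=0}^N\subset X^h$, $(q_h^n)_{n=2}^N\subset Q^h$ satisfy the BDF2-IMEX scheme: for $n=1,\dots,N-1$, all $w^h\in X^h$ and all $\lambda^h\in Q^h$, $$\Big(\frac{3v_h^{n+1}-4v_h^n+v_h^{n-1}}{2\Delta t},w^h\Big)+\nu(\nabla v_h^{n+1},\nabla w^h)+b^*(2v_h^n-v_h^{n-1},v_h^{n+1},w^h)$$ $$-\chi\big(I_H(u(t_{n+1}))-I_H(v_h^{n+1}),w^h\big)-(q_h^{n+1},\nabla\cdot w^h)=(f(t_{n+1}),w^h),$$ $$(\nabla\cdot v_h^{n+1},\lambda^h)-\mu_1(I_H(p(t_{n+1})-q_h^{n+1}),\lambda^h)-\mu_2(I_H(q_h^{n+1})-q_h^{n+1},\lambda^h)=0.$$ Assume $I_H$ is an $L^2$-projection. Then $$\|v_h^N\|^2+\|2v_h^N-v_h^{N-1}\|^2-\|v_h^1\|^2-\|2v_h^1-v_h^0\|^2+\sum_{n=1}^{N-1}\|v_h^{n+1}-2v_h^n+v_h^{n-1}\|^2$$ $$+2\Delta t\sum_{n=1}^{N-1}\Big[\nu\|\nabla v_h^{n+1}\|^2+\chi\|I_H(v_h^{n+1})\|^2+\alpha_1\|q_h^{n+1}\|^2\Big]$$ $$\le 2\Delta t\sum_{n=1}^{N-1}\Big[\frac1\nu\|f(t_{n+1})\|_{-1}^2+\mu_1\|I_H(p(t_{n+1}))\|^2+\chi\|I_H(u(t_{n+1}))\|^2\Big],$$ where $\alpha_1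=\min\{\mu_1,2\mu_2\}$.
   Context: $\Omega\subset\mathbb{R}^d$, $d=2$ or $3$, is a domain; $\|\cdot\|$ and $(\cdot,\cdot)$ are the $L^2(\Omega)$ norm and inner product. $X=(H_0^1(\Omega))^d$, $Q=L_0^2(\Omega)$ (mean-zero $L^2$ functions), and $X^h\subset X$, $Q^h\subset Q$ are conforming finite element spaces. The dual norm is $\|f\|_{-1}=\sup_{0\ne v\in X}\langle f,v\rangle/\|\nabla v\|$. The skew-symmetrized trilinear form is $b^*(u,v,w)=\frac12(u\cdot\nabla v,w)-\frac12(u\cdot\nabla w,v)$. $\nu>0$ is the viscosity, $\chi>0$ the velocity nudging parameter, $\mu_1,\mu_2>0$ the pressure nudging parameters, $f$ the body force. $\Delta t>0$ is the time step, $t_n=n\Delta t$, $N=T/\Delta t$; $v_h^0,v_h^1\in X^h$ are given starting values. $I_H$ is the observation operator of spatial resolution $H$, applied to both velocities (vector functions) and pressures (scalar functions); that it is an $L^2$-projection means it is the orthogonal projection in $L^2$ onto its range. $(u,p)$ is the reference velocity and pressure (a solution of the slightly compressible Navier--Stokes equations) whose observations are the given data. *)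

(* Defs.v *)
From HB Require Import structures.
From mathcomp Require Import all_boot all_order all_algebra.
From mathcomp Require Import all_classical all_reals all_analysis measurable_realfun.
Set Implicit Arguments. Unset Strict Implicit. Unset Printing Implicit Defensive.
Import Order.TTheory GRing.Theory Num.Theory.
Import numFieldNormedType.Exports.
Local Open Scope classical_set_scope.
Local Open Scope ring_scope.

(* The product sigma-algebra on R^n, which is the Borel one. *)
Section rV_measurable.
Variables (R : realType) (n : nat).

Let coors : 'I_n -> 'rV[R]_n -> measurableTypeR R := fun i x => x ord0 i.

Let rV_set0 : g_sigma_preimage coors set0.
Proof. exact: sigma_algebra0. Qed.

Let rV_setC A : g_sigma_preimage coors A -> g_sigma_preimage coors (~` A).
Proof. exact: sigma_algebraC. Qed.

Let rV_bigcup (F : _^nat) : (forall i, g_sigma_preimage coors (F i)) ->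
  g_sigma_preimage coors (\bigcup_i (F i)).
Proof. exact: sigma_algebra_bigcup. Qed.

HB.instance Definition _ := @isMeasurable.Build
  (measure_tuple_display R.-ocitv.-measurable.-sigma) 'rV[R]_n
  (g_sigma_preimage coors) rV_set0 rV_setC rV_bigcup.

Lemma measurable_coord (i : 'I_n) :
  measurable_fun [set: 'rV[R]_n]
    (fun x : 'rV[R]_n => x ord0 i : measurableTypeR R).
Proof.
move=> _ Y mY; rewrite setTI; apply: sub_sigma_algebra => /=.
rewrite -bigcup_seq/=; exists i => /=; first by rewrite mem_index_enum.
by exists Y => //; rewrite setTI.
Qed.

Lemma measurable_fun_rV d (T : measurableType d) (f : T -> 'rV[R]_n) :
  (forall i, measurable_fun [set: T] (fun x => f x ord0 i : measurableTypeR R)) ->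
  measurable_fun [set: T] f.
Proof.
move=> mf.
suff preS : g_sigma_preimage (fun i => coors i \o f) `<=` measurable.
  move=> _ A mA; apply: preS.
  by rewrite g_sigma_preimage_comp; exists A.
apply: smallest_sub; first exact: sigma_algebra_measurable.
rewrite -bigcup_seq/=; apply: bigcup_sub => i _.
by move=> A [B mB <-]; exact: mf.
Qed.

End rV_measurable.

Section rV_borel.
Variables (R : realType) (n : nat).

Lemma open_measurable_rV (A : set 'rV[R]_n) : open A -> measurable A.
Proof.
move=> oA.
pose box (k : 'rV[rat]_n * rat) : set 'rV[R]_n :=
  [set x : 'rV[R]_n | forall i, `|ratr (k.1 ord0 i) - x ord0 i| < ratr k.2].
have mbox k : measurable (box k).
  rewrite (_ : box k = \bigcap_(i in [set: 'I_n])
      ((fun x : 'rV[R]_n => x ord0 i) @^-1`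
        (ball (ratr (k.1 ord0 i) : R) (ratr k.2)))); last first.
    by apply/seteqP; split=> x /= xk i => [_|]; [exact: xk|exact: (xk i I)].
  apply: fin_bigcap_measurable => // i _.
  rewrite -[X in measurable X]setTI; apply: measurable_coord => //.
  exact: measurable_ball.
rewrite (_ : A = \bigcup_k (if `[< box k `<=` A >] then box k else set0)).
  apply: countable_bigcupT_measurable => [|k]; first exact: countableP.
  by case: asboolP => _; [exact: mbox|exact: measurable0].
apply/seteqP; split=> [x Ax|x [k _]]; last by case: asboolP => // kA; exact: kA.
have /nbhs_ballP[e /= e0 xeA] : nbhs x A by exact: open_nbhs_nbhs.
have [r] := rat_in_itvoo (divr_gt0 e0 (ltr0n R 2)).
rewrite in_itv/= => /andP[r0 re].
have H (i : 'I_n) : exists q : rat, `|ratr q - x ord0 i| < ratr r.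
  have [q] : exists q : rat,
      ratr q \in `](x ord0 i - ratr r), (x ord0 i + ratr r)[.
    by apply: rat_in_itvoo; rewrite ltrD2l gtrN.
  by rewrite in_itv/= => /andP[q1 q2]; exists q; rewrite ltr_distl q1 q2.
pose q i := projT1 (cid (H i)).
have qP i : `|ratr (q i) - x ord0 i| < ratr r by exact: (projT2 (cid (H i))).
exists (\row_i q i, r) => //; case: asboolP => [_|[]].
  by move=> i; rewrite mxE.
move=> y/= yk; apply: xeA; split => // i j.
rewrite ord1 /ball/= [e]splitr -[x _ _ - _](subrKA (ratr (q j))).
rewrite (le_lt_trans (ler_normD _ _))// ltrD//.
  by rewrite distrC (lt_trans (qP j)).
by move: (yk j); rewrite /= mxE => /lt_trans; exact.
Qed.

End rV_borel.

Section cons_rV.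
Variables (R : realType) (n : nat).

Definition cons_rV (p : measurableTypeR R * 'rV[R]_n) : 'rV[R]_n.+1 :=
  \row_i (if unlift ord0 i is Some j then p.2 ord0 j else p.1).

Lemma measurable_cons_rV :
  measurable_fun [set: measurableTypeR R * 'rV[R]_n] cons_rV.
Proof.
apply: measurable_fun_rV => i.
under eq_fun do rewrite mxE.
case: (unliftP ord0 i) => [j _|_]; last exact: measurable_fst.
exact: (measurableT_comp (@measurable_coord R n j) measurable_snd).
Qed.

Let uncons_rV (x : 'rV[R]_n.+1) : measurableTypeR R * 'rV[R]_n :=
  (x ord0 ord0, \row_j x ord0 (lift ord0 j)).

Let cons_rVK : cancel cons_rV uncons_rV.
Proof.
move=> [x v]; congr (_, _); first by rewrite mxE unlift_none.
by apply/rowP => j; rewrite !mxE liftK.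
Qed.

Let uncons_rVK : cancel uncons_rV cons_rV.
Proof.
move=> x; apply/rowP => i; rewrite mxE.
by case: (unliftP ord0 i) => [j ->|->] //=; rewrite mxE.
Qed.

Let measurable_uncons_rV : measurable_fun [set: 'rV[R]_n.+1] uncons_rV.
Proof.
apply: measurable_fun_pair; first exact: measurable_coord.
apply: measurable_fun_rV => i.
by under eq_fun do rewrite mxE; exact: measurable_coord.
Qed.

Variable mu : {sigma_finite_measure set 'rV[R]_n -> \bar R}.
Let mf := measurable_cons_rV.

Definition lebesgue_rV_succ : set 'rV[R]_n.+1 -> \bar R :=
  pushforward (@lebesgue_measure R \x mu)%E cons_rV.

Let lebesgue_rV_succ0 : lebesgue_rV_succ set0 = 0%E.
Proof. exact: measure0. Qed.

Let lebesgue_rV_succ_ge0 A : (0 <= lebesgue_rV_succ A)%E.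
Proof. exact: measure_ge0. Qed.

Let lebesgue_rV_succ_sigma_additive : semi_sigma_additive lebesgue_rV_succ.
Proof. exact: (@measure_semi_sigma_additive _ _ _ (pushforward _ _)). Qed.

HB.instance Definition _ := isMeasure.Build _ _ _ lebesgue_rV_succ
  lebesgue_rV_succ0 lebesgue_rV_succ_ge0 lebesgue_rV_succ_sigma_additive.

Let lebesgue_rV_succ_sigma_finite : sigma_finite setT lebesgue_rV_succ.
Proof.
pose l : {sigma_finite_measure set (measurableTypeR R) -> \bar R} :=
  @lebesgue_measure R.
have /sigma_finiteP[F [FT ndF Foo]] := sigma_finiteT l.
have /sigma_finiteP[G [GT ndG Goo]] := sigma_finiteT mu.
exists (fun i => uncons_rV @^-1` (F i `*` G i)).
  apply/esym; rewrite -subTset => x _.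
  have [i _ Fi] : (\bigcup_i F i) (uncons_rV x).1 by rewrite -FT.
  have [j _ Gj] : (\bigcup_i G i) (uncons_rV x).2 by rewrite -GT.
  exists (maxn i j) => //; split.
    by move: Fi; exact/subsetPset/ndF/leq_maxl.
  by move: Gj; exact/subsetPset/ndG/leq_maxr.
move=> i; have [mF Fy] := Foo i; have [mG Gy] := Goo i; split.
  rewrite -[X in measurable X]setTI; apply: measurable_uncons_rV => //.
  exact: measurableX.
rewrite /lebesgue_rV_succ /pushforward -comp_preimage.
rewrite (_ : uncons_rV \o cons_rV = id) ?preimage_id; last exact/funext.
by rewrite product_measure1E// lte_mul_pinfty// ge0_fin_numE.
Qed.

HB.instance Definition _ := Measure_isSigmaFinite.Build _ _ _ lebesgue_rV_succ
  lebesgue_rV_succ_sigma_finite.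

End cons_rV.

Fixpoint lebesgue_rV (R : realType) n :
    {sigma_finite_measure set 'rV[R]_n -> \bar R} :=
  if n is m.+1 then lebesgue_rV_succ (lebesgue_rV R m) else \d_(0 : 'rV[R]_0).

Lemma lebesgue_rV_box (R : realType) n (a b : 'I_n -> R) :
  (forall i, a i <= b i) ->
  lebesgue_rV R n [set x : 'rV[R]_n | forall i, x ord0 i \in `]a i, b i]] =
  (\prod_i (b i - a i))%:E.
Proof.
elim: n a b => [|n IH] a b ab.
  rewrite big_ord0 /= diracE mem_set//=.
  by move=> [].
rewrite /= /lebesgue_rV_succ /pushforward big_ord_recl.
rewrite (_ : _ @^-1` _ = `]a ord0, b ord0]%classic `*`
    [set x : 'rV[R]_n | forall i,
      x ord0 i \in `]a (lift ord0 i), b (lift ord0 i)]]).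
  rewrite product_measure1E//=.
  - rewrite IH; last by move=> i; exact: ab.
    rewrite lebesgue_measure_itv/= lte_fin.
    have := ab ord0; rewrite le_eqVlt => /predU1P[->|->]; last first.
      by rewrite -EFinB -EFinM.
    by rewrite ltxx mul0e subrr mul0r.
  - rewrite (_ : mkset _ = \bigcap_(i in [set: 'I_n])
        ((fun x : 'rV[R]_n => x ord0 i) @^-1`
          `]a (lift ord0 i), b (lift ord0 i)]%classic)).
      apply: fin_bigcap_measurable => // i _.
      by rewrite -[X in measurable X]setTI; apply: measurable_coord.
    apply/seteqP; split=> [x xk i _|x xk i]; first exact: xk.
    exact: (xk i I).
apply/seteqP; split=> [[x v]/= H|[x v]/= [Hx Hv] i].
  split; first by have := H ord0; rewrite mxE unlift_none.
  by move=> i; have := H (lift ord0 i); rewrite mxE liftK.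
by rewrite mxE; case: unliftP => [j ->|->].
Qed.

Notation sfield R d := ('rV[R]_d -> R).
Notation mfield R d m n := ('rV[R]_d -> 'M[R]_(m, n)).
Notation vfield R d := ('rV[R]_d -> 'rV[R]_d).

Record domain (R : realType) (d : nat) := Domain {
  domain_set :> set 'rV[R]_d;
  domain_open : open domain_set;
  domain_connected : connected domain_set;
  domain_nonempty : domain_set !=set0 }.
Arguments domain_open {R d} _.

Section function_spaces.
Variables (R : realType) (d : nat) (Omega : domain R d).

Definition vol : {measure set 'rV[R]_d -> \bar R} :=
  mrestr (lebesgue_rV R d) (open_measurable_rV (domain_open Omega)).

(* As in the library, elements of L^2(Omega) are represented by functions
   instead of classes modulo a.e. equality. These functions are total on R^d,
   but [vol] only sees their values on Omega. *)
Definition sL2 : set (sfield R d) := [set f | f \in Lfun vol 2%:E].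

Definition mL2 m n : set (mfield R d m n) :=
  [set F | forall i j, sL2 (fun x => F x i j)].

Definition vL2 : set (vfield R d) := @mL2 1 d.

Definition sinner (f g : sfield R d) : R := \int[vol]_x (f x * g x).

Definition minner m n (F G : mfield R d m n) : R :=
  \int[vol]_x (\sum_i \sum_j F x i j * G x i j).

Definition snorm f := Num.sqrt (sinner f f).
Definition mnorm m n (F : mfield R d m n) := Num.sqrt (minner F F).

Definition pderiv (i : 'I_d) (f : sfield R d) : sfield R d :=
  fun x => 'D_(delta_mx ord0 i) f x.

Definition smooth (f : sfield R d) :=
  forall (s : seq 'I_d) x, differentiable (foldr pderiv f s) x.

Definition test_function (phi : sfield R d) :=
  let supp := closure [set x | phi x != 0] in
  [/\ smooth phi, compact supp & supp `<=` Omega].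

Definition weak_pderiv (i : 'I_d) (f g : sfield R d) :=
  sL2 g /\ forall phi, test_function phi ->
    sinner f (pderiv i phi) = - sinner g phi.

(* A representative of the weak derivative, meaningful only if one exists. *)
Definition wpderiv (i : 'I_d) (f : sfield R d) : sfield R d :=
  xget 0 [set g | weak_pderiv i f g].

Definition H1 : set (sfield R d) :=
  [set f | sL2 f /\ forall i, exists g, weak_pderiv i f g].

(* The closure of the test functions for the norm of H^1(Omega). *)
Definition H10 : set (sfield R d) :=
  [set f | H1 f /\ forall e, 0 < e -> exists2 phi, test_function phi &
    snorm (f - phi) ^+ 2 +
    \sum_i snorm (wpderiv i f - pderiv i phi) ^+ 2 < e ^+ 2].

Definition H10_vec : set (vfield R d) :=
  [set v | forall i, H10 (fun x => v x ord0 i)].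

Definition L2_0 : set (sfield R d) :=
  [set q | sL2 q /\ (\int[vol]_x (q x)%:E = 0)%E].

Definition grad (v : vfield R d) : mfield R d d d :=
  fun x => \matrix_(i, j) wpderiv j (fun y => v y ord0 i) x.

Definition div (v : vfield R d) : sfield R d :=
  fun x => \sum_i wpderiv i (fun y => v y ord0 i) x.

(* (u . grad) v, with components \sum_j u_j d_j v_i. *)
Definition advect (u v : vfield R d) : vfield R d :=
  fun x => u x *m (grad v x)^T.

Definition bstar (u v w : vfield R d) : R :=
  2^-1 * minner (advect u v) w - 2^-1 * minner (advect u w) v.

(* Linear functionals on (H^1_0)^d modulo a.e. equality. Those with a finite
   [dual_norm] are the elements of the dual space; the L^2 functions act as
   functionals through the inner product, see [L2_functional]. *)
Definition H10_functional (f : vfield R d -> R) :=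
  (forall a v w, H10_vec v -> H10_vec w -> f (a *: v + w) = a * f v + f w) /\
  (forall v w, H10_vec v -> H10_vec w -> v = w %[ae vol] -> f v = f w).

(* Extended-real division has 1 / 0 = +oo, hence the quotient is the expected
   one even before knowing that the gradient of a nonzero v does not vanish. *)
Definition dual_norm (f : vfield R d -> R) : \bar R :=
  ereal_sup [set ((f v)%:E / (mnorm (grad v))%:E)%E |
             v in [set v | H10_vec v /\ ~ (v = 0 %[ae vol])]].

End function_spaces.
Arguments H10_vec {R d}.
Arguments L2_0 {R d}.
Arguments minner {R d} Omega {m n}.
Arguments mnorm {R d} Omega {m n}.

Lemma L2_functional (R : realType) (d : nat) (Omega : domain R d)
  (g : vfield R d) : vL2 Omega g -> H10_functional Omega (minner Omega g).
Proof.
move=> gL2.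
have int v : H10_vec Omega v -> (vol Omega).-integrable setT
    (EFin \o (fun x => \sum_i \sum_j g x i j * v x i j)).
  move=> vX.
  rewrite (_ : _ \o _ = fun x => (\sum_i \sum_j (g x i j * v x i j)%:E)%E);
      last first.
    apply/funext => x /=; rewrite -sumEFin; apply: eq_bigr => i _.
    by rewrite -sumEFin.
  apply: integrable_sum => //= i _; apply: integrable_sum => //= j _.
  apply/Lfun1_integrable/Lfun2_mul_Lfun1; first exact: gL2.
  by rewrite ord1; case: (vX j) => -[].
split=> [a v w vX wX|v w vX wX vw].
  rewrite /minner -RintegralZl//; last exact: int.
  rewrite -RintegralD//; first last.
  - exact: int.
  - have := integrableZl measurableT a (int _ vX).
    by apply: eq_integrable => // x _; rewrite /= EFinM.
  apply: eq_Rintegral => x _.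
  rewrite mulr_sumr -big_split/=; apply: eq_bigr => i _.
  rewrite mulr_sumr -big_split/=; apply: eq_bigr => j _.
  by rewrite !mxE mulrDr mulrCA.
congr fine; apply: ae_eq_integral => //.
- by have /integrableP[] := int _ vX.
- by have /integrableP[] := int _ wX.
- by apply: filterS vw => x /= /(_ I) -> _.
Qed.

Section abstract_spaces.
Variables (R : realType) (V : lmodType R).

(* Conforming finite element spaces, as finite-dimensional subspaces of W. *)
Definition fe_space (W M : set V) :=
  M `<=` W /\ exists k (b : 'I_k -> V),
    M = [set \sum_i c i *: b i | c in [set: 'I_k -> R]].

(* P is the orthogonal projection of the inner product space L onto a linear
   subspace M, which is then the range of P modulo null vectors. *)
Definition orthogonal_projection (L : set V) (ip : V -> V -> R) (P : V -> V) :=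
  exists M : set V, [/\ M `<=` L,
    M 0 /\ (forall a f g, M f -> M g -> M (a *: f + g)),
    forall f, L f -> M (P f) &
    forall f m, L f -> M m -> ip (f - P f) m = 0].

End abstract_spaces.

(* Main.v *)
Require Import Defs.
From HB Require Import structures.
From mathcomp Require Import all_boot all_order all_algebra.
From mathcomp Require Import all_classical all_reals all_analysis measurable_realfun.
From mathcomp Require Import ring lra.
Set Implicit Arguments. Unset Strict Implicit. Unset Printing Implicit Defensive.
Import Order.TTheory GRing.Theory Num.Theory.
Import numFieldNormedType.Exports.
Local Open Scope classical_set_scope.
Local Open Scope ring_scope.


(* Test the momentum equation with w = v^{n+1} and the continuity equation with
   l = q^{n+1}: the convective term vanishes by skew-symmetry and the pressure
   terms combine. The BDF2 polarization identity turns the discrete time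
   derivative into a telescoping difference plus the square of the second
   difference. As I_H is self-adjoint and idempotent up to null vectors, the
   nudging terms become (I_H u - I_H v, I_H v) <= (|I_H u|^2 - |I_H v|^2) / 2, and
   mu1 |I_H q|^2 + 2 mu2 (|q|^2 - |I_H q|^2) >= min(mu1, 2 mu2) |q|^2 because I_H
   is a contraction. Young's inequality absorbs the force into the viscous term. *)

(** * Algebra of semi-definite inner products *)

Section semi_inner_product.
Variables (R : realType) (V : lmodType R).

(* Only semi-definite: L^2 is represented by functions instead of classes. *)
Definition semi_inner_product (L : set V) (ip : V -> V -> R) :=
  [/\ forall a f g, L f -> L g -> L (a *: f + g),
      forall f g, ip f g = ip g f,
      forall a f g h, L f -> L g -> L h ->
        ip (a *: f + g) h = a * ip f h + ip g h &
      forall f, 0 <= ip f f].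

Variables (L : set V) (ip : V -> V -> R).
Hypothesis ipP : semi_inner_product L ip.

Let ip_closed a f g : L f -> L g -> L (a *: f + g).
Proof. by case: ipP => + _ _ _; exact. Qed.

Let ip_sym f g : ip f g = ip g f.
Proof. by case: ipP => _ + _ _; exact. Qed.

Let ip_lin a f g h : L f -> L g -> L h ->
  ip (a *: f + g) h = a * ip f h + ip g h.
Proof. by case: ipP => _ _ + _; exact. Qed.

Let ip_ge0 f : 0 <= ip f f.
Proof. by case: ipP. Qed.

Lemma semi_ip_closed0 f : L f -> L 0.
Proof. by move=> Lf; rewrite -(addNr f) -scaleN1r; exact: ip_closed. Qed.

Lemma semi_ip_closedZ a f : L f -> L (a *: f).
Proof.
by move=> Lf; rewrite -[_ *: _]addr0; apply: ip_closed => //;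
  exact: semi_ip_closed0 Lf.
Qed.

Lemma semi_ip_closedB f g : L f -> L g -> L (f - g).
Proof. by move=> Lf Lg; rewrite addrC -scaleN1r; exact: ip_closed. Qed.

Lemma semi_ip0l f : L f -> ip 0 f = 0.
Proof.
move=> Lf; have := ip_lin (-1) Lf Lf Lf.
by rewrite scaleN1r addNr mulN1r addNr.
Qed.

Lemma semi_ipZl a f g : L f -> L g -> ip (a *: f) g = a * ip f g.
Proof.
move=> Lf Lg; rewrite -[_ *: f]addr0 ip_lin ?semi_ip0l ?addr0//.
exact: semi_ip_closed0 Lf.
Qed.

Lemma semi_ipBl f g h : L f -> L g -> L h -> ip (f - g) h = ip f h - ip g h.
Proof.
by move=> Lf Lg Lh; rewrite addrC -scaleN1r ip_lin// mulN1r addrC.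
Qed.

(** Both sides are quadratic forms in [a], [b], [c], which stand for the new, current and previous
    velocities; their six coefficients agree. *)
Lemma bdf2_identity a b c : L a -> L b -> L c ->
  2 * ip (3 *: a - 4 *: b + c) a =
  ip a a + ip (2 *: a - b) (2 *: a - b) - ip b b
  - ip (2 *: b - c) (2 *: b - c) + ip (a - 2 *: b + c) (a - 2 *: b + c).
Proof.
move=> La Lb Lc.
have lcE (k l m : R) h : L h ->
    ip (k *: a + (l *: b + m *: c)) h = k * ip a h + (l * ip b h + m * ip c h).
  move=> Lh; have Lmc : L (m *: c) by exact: semi_ip_closedZ.
  by rewrite ip_lin ?ip_lin ?semi_ipZl//; exact: ip_closed.
have lcL (k l m : R) : L (k *: a + (l *: b + m *: c)).
  by do 2 apply: ip_closed => //; exact: semi_ip_closedZ.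
have lc2 (k l m k' l' m' : R) :
    ip (k *: a + (l *: b + m *: c)) (k' *: a + (l' *: b + m' *: c)) =
    k * k' * ip a a + l * l' * ip b b + m * m' * ip c c +
    (k * l' + l * k') * ip a b + (k * m' + m * k') * ip a c +
    (l * m' + m * l') * ip b c.
  rewrite lcE// ![ip _ (_ + _)]ip_sym !lcE// (ip_sym b a) (ip_sym c a).
  by rewrite (ip_sym c b); ring.
(* Each vector is padded to a combination of all three, the form that [lc2] and [lcE] expand. *)
have -> : 3 *: a - 4 *: b + c = 3 *: a + ((-4) *: b + 1 *: c).
  by rewrite scaleNr scale1r addrA.
have -> : 2 *: a - b = 2 *: a + ((-1) *: b + 0 *: c).
  by rewrite scaleN1r scale0r addr0.
have -> : 2 *: b - c = 0 *: a + (2 *: b + (-1) *: c).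
  by rewrite scaleN1r scale0r add0r.
have -> : a - 2 *: b + c = 1 *: a + ((-2) *: b + 1 *: c).
  by rewrite scaleNr !scale1r addrA.
rewrite !lc2 lcE// (ip_sym b a) (ip_sym c a); ring.
Qed.

(** * Orthogonal projections up to null vectors *)

Section projection.
Variable P : V -> V.
Hypothesis Pproj : orthogonal_projection L ip P.

Lemma proj_closed f : L f -> L (P f).
Proof. by case: Pproj => M [ML _ PM _] Lf; apply/ML/PM. Qed.

(** The residual [g - P g] is orthogonal to [P f], which lies in the range. By symmetry [P] is then
    self-adjoint under [ip]. *)
Lemma proj_ipl f g : L f -> L g -> ip (P f) g = ip (P f) (P g).
Proof.
case: Pproj => M [ML _ PM orth] Lf Lg.
have := orth _ _ Lg (PM _ Lf).
rewrite semi_ipBl//; [|exact: proj_closed..].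
by move/subr0_eq => e; rewrite ip_sym e ip_sym.
Qed.

(** [P] is determined only up to null vectors, so additivity is recovered under [ip]:
    self-adjointness moves [P] onto [h]. *)
Lemma proj_ipBl f g h : L f -> L g -> L h ->
  ip (P (f - g)) h = ip (P f - P g) h.
Proof.
move=> Lf Lg Lh; have Lfg := semi_ip_closedB Lf Lg.
have adj k l : L k -> L l -> ip (P k) l = ip k (P l).
  by move=> Lk Ll; rewrite proj_ipl// ip_sym -proj_ipl// ip_sym.
have LP k : L k -> L (P k) by exact: proj_closed.
by rewrite adj// !semi_ipBl ?adj//; exact: LP.
Qed.

(** Pythagoras: the gap is the square of the residual [f - P f]. *)
Lemma proj_contraction f : L f -> ip (P f) (P f) <= ip f f.
Proof.
move=> Lf; have LPf := proj_closed Lf.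
have := ip_ge0 (f - P f).
have Lr : L (f - P f) by exact: semi_ip_closedB.
rewrite semi_ipBl// ![ip _ (f - _)]ip_sym !semi_ipBl// (ip_sym f (P f)).
have := proj_ipl Lf Lf; lra.
Qed.

(** By [proj_ipl], [g] may be replaced by [P g] on the left; the gap is then the square of
    [P f - P g]. *)
Lemma proj_nudging f g : L f -> L g ->
  2 * ip (P f - P g) g <= ip (P f) (P f) - ip (P g) (P g).
Proof.
move=> Lf Lg; have [LPf LPg] := (proj_closed Lf, proj_closed Lg).
have := ip_ge0 (P f - P g).
have Lr : L (P f - P g) by exact: semi_ip_closedB.
rewrite semi_ipBl// ![ip _ (P f - P g)]ip_sym !semi_ipBl//
  (ip_sym (P g) (P f)).
have := proj_ipl Lf Lg; have := proj_ipl Lg Lg; lra.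
Qed.

End projection.

End semi_inner_product.

(** * The L^2 products and the dual norm *)

Section L2_inner_products.
Variables (R : realType) (d : nat) (Omega : domain R d).

Lemma sL2_comb (a : R) f g : sL2 Omega f -> sL2 Omega g ->
  sL2 Omega (a *: f + g).
Proof.
have le12 : (1 <= 2%:E :> \bar R)%E by rewrite lee_fin ler1n.
have [_ clo] := Lfun_submod_closed (vol Omega) le12.
exact: clo.
Qed.

Lemma sL2_mul_integrable f g : sL2 Omega f -> sL2 Omega g ->
  (vol Omega).-integrable setT (EFin \o (f \* g)).
Proof. by move=> Lf Lg; apply/Lfun1_integrable/Lfun2_mul_Lfun1. Qed.

Lemma sinnerC f g : sinner Omega f g = sinner Omega g f.
Proof. by apply: eq_Rintegral => x _; rewrite mulrC. Qed.

Lemma sinner_semi_ip : semi_inner_product (sL2 Omega) (sinner Omega).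
Proof.
split.
- exact: sL2_comb.
- exact: sinnerC.
- move=> a f g h Lf Lg Lh; rewrite /sinner -RintegralZl//; last first.
    exact: sL2_mul_integrable.
  rewrite -RintegralD//; first last.
  + exact: sL2_mul_integrable.
  + have := integrableZl measurableT a (sL2_mul_integrable Lf Lh).
    by apply: eq_integrable => // x _; rewrite /= EFinM.
  + by apply: eq_Rintegral => x _; rewrite /= mulrDl mulrA.
- by move=> f; apply: Rintegral_ge0 => x _; rewrite -expr2 sqr_ge0.
Qed.

(** Entrywise products are integrable, so the integral commutes with the finite sums; [minner] thus
    inherits linearity from [sinner]. *)
Lemma minnerE m n (F G : mfield R d m n) : mL2 Omega F -> mL2 Omega G ->
  minner Omega F G =
  \sum_i \sum_j sinner Omega (fun x => F x i j) (fun x => G x i j).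
Proof.
move=> LF LG.
have int i j : (vol Omega).-integrable setT
    (fun x => (F x i j * G x i j)%:E).
  exact: (sL2_mul_integrable (LF i j) (LG i j)).
have -> : minner Omega F G =
    fine (\int[vol Omega]_x \sum_i \sum_j (F x i j * G x i j)%:E)%E.
  congr fine; apply: eq_integral => x _.
  by rewrite -sumEFin; apply: eq_bigr => i _; rewrite -sumEFin.
have sumint i : (vol Omega).-integrable setT
    (fun x => \sum_j (F x i j * G x i j)%:E)%E.
  exact: integrable_sum.
rewrite integral_sum// -sum_fine => [|i _]; last exact: integrable_fin_num.
apply: eq_bigr => i _; rewrite integral_sum// -sum_fine// => j _.
exact: integrable_fin_num.
Qed.

Lemma minner_semi_ip m n :
  semi_inner_product (@mL2 R d Omega m n) (minner Omega).
Proof.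
have comb a F G : @mL2 R d Omega m n F -> mL2 Omega G -> mL2 Omega (a *: F + G).
  move=> LF LG i j.
  rewrite (_ : (fun x => _) = a *: (fun x => F x i j) + (fun x => G x i j)).
    by apply: sL2_comb; [exact: LF|exact: LG].
  by apply/funext => x; rewrite !mxE.
split => //.
- move=> F G; apply: eq_Rintegral => x _.
  by apply: eq_bigr => i _; apply: eq_bigr => j _; rewrite mulrC.
- move=> a F G H LF LG LH; rewrite !minnerE//; last exact: comb.
  rewrite mulr_sumr -big_split/=; apply: eq_bigr => i _.
  rewrite mulr_sumr -big_split/=; apply: eq_bigr => j _.
  have [_ _ sinner_lin _] := sinner_semi_ip; rewrite -sinner_lin//.
  by congr sinner; apply/funext => x; rewrite !mxE.
- move=> F; apply: Rintegral_ge0 => x _.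
  by do 2 apply: sumr_ge0 => ? _; rewrite -expr2 sqr_ge0.
Qed.

Lemma sqr_snorm f : snorm Omega f ^+ 2 = sinner Omega f f.
Proof. by rewrite sqr_sqrtr//; have [_ _ _ ->] := sinner_semi_ip. Qed.

Lemma sqr_mnorm m n (F : mfield R d m n) :
  mnorm Omega F ^+ 2 = minner Omega F F.
Proof. by rewrite sqr_sqrtr//; have [_ _ _ ->] := minner_semi_ip m n. Qed.

Lemma H10_vec_L2 v : H10_vec Omega v -> vL2 Omega v.
Proof. by move=> vX i j; rewrite ord1; case: (vX j) => -[]. Qed.

(** With [D] the dual norm and [g] the gradient norm, [f v <= D * g] is combined with Young's
    inequality; [D] may be infinite. *)
Lemma dual_norm_young (f : vfield R d -> R) v (nu : R) : 0 < nu ->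
  H10_vec Omega 0 -> H10_vec Omega v -> H10_functional Omega f ->
  ((2 * f v - nu * mnorm Omega (grad Omega v) ^+ 2)%:E <=
   (nu^-1)%:E * dual_norm Omega f ^+ 2)%E.
Proof.
move=> nu0 X0 vX [flin fae].
set g := mnorm _ _.
have g0 : 0 <= g by exact: sqrtr_ge0.
have rhs0 : (0 <= (nu^-1)%:E * dual_norm Omega f ^+ 2)%E.
  by rewrite mule_ge0 ?sqre_ge0// lee_fin invr_ge0 ltW.
have [fv0|fv0] := leP (f v) 0.
  apply: le_trans rhs0; rewrite lee_fin.
  by have := mulr_ge0 (ltW nu0) (sqr_ge0 g); lra.
(* A null [v] would give [f v = f 0 = 0], against [0 < f v]. *)
have vN0 : ~ v = 0 %[ae vol Omega].
  move=> /(fae _ _ vX X0) fvE.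
  have := flin 1 0 0 X0 X0; rewrite scale1r addr0; lra.
have : (((f v)%:E / g%:E) <= dual_norm Omega f)%E.
  by apply: ereal_sup_ubound; exists v.
have inf : ((nu^-1)%:E * +oo ^+ 2 = +oo :> \bar R)%E.
  by rewrite expe2 mulyy gt0_muley// lte_fin invr_gt0.
(* If [g = 0], the quotient is [+oo] because [f v] is positive, so the dual norm is [+oo] and the
   bound is trivial. *)
have [->|gN0] := eqVneq g 0.
  by rewrite inve0 gt0_muley ?lte_fin// leye_eq => /eqP ->; rewrite inf leey.
case: (dual_norm Omega f) => [D| |]; last 2 first.
- by rewrite inf !leey.
- by rewrite inver (negbTE gN0) -EFinM leeNy_eq => /eqP.
have {}g0 : 0 < g by rewrite lt_def gN0.
rewrite inver (negbTE gN0) -EFinM lee_fin ler_pdivrMr// => fD.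
rewrite -EFin_expe -EFinM lee_fin -subr_ge0.
(* Completing the square; the remainder is nonnegative by [fD]. *)
have -> : nu^-1 * D ^+ 2 - (2 * f v - nu * g ^+ 2) =
    nu^-1 * (D - nu * g) ^+ 2 + 2 * (D * g - f v).
  by field; rewrite gt_eqF.
rewrite addr_ge0//; first by rewrite mulr_ge0 ?sqr_ge0// invr_ge0 ltW.
by rewrite mulr_ge0// subr_ge0.
Qed.

End L2_inner_products.

(** * The energy estimate of the scheme *)

Lemma fe_space0 (R : realType) (V : lmodType R) (W M : set V) :
  fe_space W M -> M 0.
Proof.
case=> _ [k [b ->]]; exists (fun=> 0) => //.
by rewrite big1// => i _; rewrite scale0r.
Qed.

Theorem theorem2p3 (R : realType) (d : nat) (d23 : d = 2%N \/ d = 3%N)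
  (Omega : domain R d)
  (Xh : set (vfield R d)) (Qh : set (sfield R d))
  (XhX : fe_space (H10_vec Omega) Xh) (QhQ : fe_space (L2_0 Omega) Qh)
  (IHv : vfield R d -> vfield R d) (IHs : sfield R d -> sfield R d)
  (IHv_proj : orthogonal_projection (vL2 Omega) (minner Omega) IHv)
  (IHs_proj : orthogonal_projection (sL2 Omega) (sinner Omega) IHs)
  (nu chi mu1 mu2 T dt : R) (nu_gt0 : 0 < nu) (chi_gt0 : 0 < chi)
  (mu1_gt0 : 0 < mu1) (mu2_gt0 : 0 < mu2) (T_gt0 : 0 < T) (dt_gt0 : 0 < dt)
  (N : nat) (N_ge2 : (2 <= N)%N) (NT : N%:R = T / dt)
  (u : R -> vfield R d) (p : R -> sfield R d) (f : R -> vfield R d -> R)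
  (uL2 : forall t, 0 <= t <= T -> vL2 Omega (u t))
  (pL2 : forall t, 0 <= t <= T -> sL2 Omega (p t))
  (f_fun : forall t, 0 <= t <= T -> H10_functional Omega (f t))
  (v : nat -> vfield R d) (q : nat -> sfield R d)
  (vXh : forall n, (n <= N)%N -> Xh (v n))
  (qQh : forall n, (2 <= n <= N)%N -> Qh (q n))
  (momentum : forall n, (1 <= n <= N.-1)%N -> forall w, Xh w ->
    minner Omega ((2 * dt)^-1 *: (3 *: v n.+1 - 4 *: v n + v n.-1)) w
    + nu * minner Omega (grad Omega (v n.+1)) (grad Omega w)
    + bstar Omega (2 *: v n - v n.-1) (v n.+1) w
    - chi * minner Omega (IHv (u (n.+1%:R * dt)) - IHv (v n.+1)) w
    - sinner Omega (q n.+1) (div Omega w)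
    = f (n.+1%:R * dt) w)
  (continuity : forall n, (1 <= n <= N.-1)%N -> forall l, Qh l ->
    sinner Omega (div Omega (v n.+1)) l
    - mu1 * sinner Omega (IHs (p (n.+1%:R * dt) - q n.+1)) l
    - mu2 * sinner Omega (IHs (q n.+1) - q n.+1) l = 0) :
  ((mnorm Omega (v N) ^+ 2 + mnorm Omega (2 *: v N - v N.-1) ^+ 2
    - mnorm Omega (v 1%N) ^+ 2 - mnorm Omega (2 *: v 1%N - v 0%N) ^+ 2
    + \sum_(1 <= n < N) mnorm Omega (v n.+1 - 2 *: v n + v n.-1) ^+ 2
    + 2 * dt * \sum_(1 <= n < N)
        (nu * mnorm Omega (grad Omega (v n.+1)) ^+ 2
         + chi * mnorm Omega (IHv (v n.+1)) ^+ 2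
         + Num.min mu1 (2 * mu2) * snorm Omega (q n.+1) ^+ 2))%R%:E
   <= (2 * dt)%R%:E * \sum_(1 <= n < N)
        ((nu^-1)%R%:E * dual_norm Omega (f (n.+1%:R * dt)%R) ^+ 2
         + (mu1 * snorm Omega (IHs (p (n.+1%:R * dt))) ^+ 2)%R%:E
         + (chi * mnorm Omega (IHv (u (n.+1%:R * dt))) ^+ 2)%R%:E))%E.
Proof.
have [XhH10 _] := XhX; have [QhL20 _] := QhQ.
have vIP := minner_semi_ip Omega 1 d; have sIP := sinner_semi_ip Omega.
have vH10 n : (n <= N)%N -> H10_vec Omega (v n) by move=> /vXh /XhH10.
have vL n : (n <= N)%N -> vL2 Omega (v n) by move=> /vH10 /H10_vec_L2.
(* The telescoping BDF2 energy; it is only used for [n >= 1], where [n.-1] is the true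
   predecessor. *)
pose E n := mnorm Omega (v n) ^+ 2 + mnorm Omega (2 *: v n - v n.-1) ^+ 2.
rewrite ge0_sume_distrr => [|n _]; last first.
  rewrite !adde_ge0 ?lee_fin ?mulr_ge0 ?sqrtr_ge0 ?(ltW mu1_gt0) ?(ltW chi_gt0)//.
  by rewrite mule_ge0 ?sqre_ge0// lee_fin invr_ge0 ltW.
(* All left-hand terms are merged into one sum over [n], which reduces the estimate to a single time
   step. *)
rewrite mulr_sumr -[_ - _ - _]addrA -opprD.
rewrite -[X in _ - X]/(E 1%N) -[X in X - _]/(E N).
rewrite -(telescope_sumr E (ltnW N_ge2)) -!big_split -sumEFin.
rewrite [X in (X <= _)%E]big_nat [X in (_ <= X)%E]big_nat; apply: lee_sum => n /andP[n1 nN].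
set t := n.+1%:R * dt.
have tT : 0 <= t <= T.
  by rewrite mulr_ge0 ?(ltW dt_gt0)//= -ler_pdivlMr// -NT ler_nat.
have nN1 : (1 <= n <= N.-1)%N by rewrite n1 -ltnS prednK// ltnW.
have qn : Qh (q n.+1) by apply: qQh; rewrite ltnS n1.
have [La [Lb Lc]] : vL2 Omega (v n.+1) /\ vL2 Omega (v n) /\ vL2 Omega (v n.-1).
  split; [|split]; apply: vL; [exact: nN|exact: ltnW|].
  exact: leq_trans (leq_pred n) (ltnW nN).
have [Lq _] := QhL20 _ qn.
have young := dual_norm_young nu_gt0 (XhH10 _ (fe_space0 XhX))
  (vH10 n.+1 nN) (f_fun t tT).
rewrite -addeA -EFinD muleDr ?fin_num_adde_defl// -EFinM.
(* Young's bound replaces the dual norm, leaving an inequality between reals. *)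
apply: (@le_trans _ _ ((2 * dt)%:E * (2 * f t (v n.+1) -
    nu * mnorm Omega (grad Omega (v n.+1)) ^+ 2)%:E +
    (2 * dt * (mu1 * snorm Omega (IHs (p t)) ^+ 2 +
     chi * mnorm Omega (IHv (u t)) ^+ 2))%:E)%E); last first.
  by rewrite leeD2r// lee_pmul2l// lte_fin mulr_gt0.
rewrite -EFinM -EFinD lee_fin.
have mom := momentum n nN1 _ (vXh _ nN).
have con := continuity n nN1 _ qn.
rewrite -/t in mom con.
have bdf := bdf2_identity vIP La Lb Lc.
have nudge_v := proj_nudging vIP IHv_proj (uL2 t tT) La.
have nudge_q := proj_nudging sIP IHs_proj (pL2 t tT) Lq.
have contr_q := proj_contraction sIP IHs_proj Lq.
have C0 : 0 <= sinner Omega (IHs (q n.+1)) (IHs (q n.+1)).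
  by have [_ _ _ ->] := sIP.
(* With [S], [C], [Q] as set below, continuity becomes [S = mu1 * m - mu2 * (Q - C)], where [m] is
   the product of [IHs p - IHs q] with [q]. *)
rewrite (proj_ipBl sIP IHs_proj (pL2 t tT) Lq Lq) in con.
rewrite (semi_ipBl sIP (proj_closed IHs_proj Lq) Lq Lq) in con.
rewrite (proj_ipl sIP IHs_proj Lq Lq) sinnerC in con.
(* Tested with [v n.+1], the two halves of [bstar] coincide and cancel. *)
rewrite /bstar subrr addr0 in mom.
have L34 : vL2 Omega (3 *: v n.+1 - 4 *: v n + v n.-1).
  have [clo _ _ _] := vIP.
  rewrite -addrA -scaleNr; do 2 apply: (clo) => //.
rewrite (semi_ipZl vIP _ L34 La) in mom.
rewrite /E /= !sqr_mnorm !sqr_snorm in young *.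
set C := sinner _ (IHs (q _)) _ in contr_q C0 nudge_q con.
set Q := sinner _ (q _) (q _) in contr_q con *.
set S := sinner _ (q _) (div _ _) in mom con.
set al := Num.min _ _.
set X := minner _ (3 *: _ - _ + _) _ in mom bdf.
have mul_dt : 2 * dt * ((2 * dt)^-1 * X) = X.
  by rewrite mulVKf// mulf_neq0// gt_eqF.
(* [al] is compared with [mu1] on I_H q and with [2 * mu2] on q - I_H q. *)
have pressure : 2 * S + al * Q <= mu1 * sinner Omega (IHs (p t)) (IHs (p t)).
  have al1 : al * C <= mu1 * C by rewrite ler_wpM2r// ge_min lexx.
  have al2 : al * (Q - C) <= 2 * mu2 * (Q - C).
    by rewrite ler_wpM2r ?subr_ge0// ge_min lexx orbT.
  have := ler_wpM2l (ltW mu1_gt0) nudge_q.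
  lra.
have velocity := ler_wpM2l (ltW chi_gt0) nudge_v.
have XE : X = 2 * dt * (f t (v n.+1) + S
    + chi * minner Omega (IHv (u t) - IHv (v n.+1)) (v n.+1)
    - nu * minner Omega (grad Omega (v n.+1)) (grad Omega (v n.+1))).
  by rewrite -mul_dt -mom; ring.
(* Once [2 * dt] is cancelled, the force and viscous terms agree on both sides; what remains is the
   sum of [pressure] and [velocity]. *)
rewrite opprD addrA -bdf XE -mulrDr mulrCA -mulrDr ler_pM2l ?mulr_gt0//.
lra.
Qed.
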